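(* For $n\geq 2$ let $k_n$ be the number of ordered pairs of words $(w,z)$ over the alphabet $\{A,B,C,D\}$ satisfying: (i) both $w$ and $z$ start with the letter $A$, and $|w|+|z|=n$; (ii) $w$ and $z$ contain the same number of letters $A$; (iii) neither $w$ nor $z$ contains a $CB$-factor (a letter $C$ immediately followed by a letter $B$); (iv) for all $i$, if the $i$th letter $A$ from the right in $w$ is immediately preceded by a $C$ and immediately followed by a $B$, then the $i$th segment of $z$ from the left contains a letter $B$; (v) for all $i$, if the $i$th letter $A$ from the right in $w$ is immediately preceded by a $C$ and immediately followed by two consecutive letters $B$, then the $i$th segment of $z$ from the left contains at least two letters $B$. Let $K(x)=\sum_{n\geq 2}k_nx^n$. Then \[K(x)=\frac{x^2(1-2x)^2}{1-10x+38x^2-70x^3+66x^4-33x^5+12x^6-6x^7+4x^8-x^9}.\]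
   Context: A segment of a word $v$ over $\{A,B,C,D\}$ is a factor (consecutive letters) that starts with a letter $A$ and ends immediately before the next letter $A$, or at the end of $v$. The $i$th segment from the left is the one starting at the $i$th letter $A$ from the left. The words $w$ and $z$ need not have the same length. *)

(* Defs.v *)
From HB Require Import structures.
From mathcomp Require Import all_boot all_order all_algebra.
Set Implicit Arguments. Unset Strict Implicit. Unset Printing Implicit Defensive.
Import GRing.Theory.

Inductive letter := A | B | C | D.

Definition letter_eqb (x y : letter) : bool :=
  match x, y with
  | A, A | B, B | C, C | D, D => true
  | _, _ => false
  end.
Lemma letter_eqP : Equality.axiom letter_eqb.
Proof. by case; case; constructor. Qed.
HB.instance Definition _ := hasDecEq.Build letter letter_eqP.

Definition letter_to_nat (l : letter) : nat :=
  match l with A => 0 | B => 1 | C => 2 | D => 3 end.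
Definition nat_to_letter (n : nat) : option letter :=
  match n with 0 => Some A | 1 => Some B | 2 => Some C | 3 => Some D | _ => None end.
Lemma letterK : pcancel letter_to_nat nat_to_letter.
Proof. by case. Qed.
HB.instance Definition _ := Countable.copy letter (pcan_type letterK).
Lemma letter_enumP : Finite.axiom [:: A; B; C; D].
Proof. by case. Qed.
HB.instance Definition _ := isFinite.Build letter letter_enumP.

Definition word := seq letter.

Definition posA (w : word) : seq nat :=
  [seq i <- iota 0 (size w) | nth D w i == A].

Definition numA (w : word) : nat := count (pred1 A) w.

Definition startsA (w : word) : bool := head D w == A.

Definition noCB (w : word) : bool :=
  ~~ has (fun i => (nth D w i == C) && (nth D w i.+1 == B)) (iota 0 (size w)).

Definition segment (z : word) (j : nat) : word :=
  let s := nth (size z) (posA z) j in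
  let e := nth (size z) (posA z) j.+1 in
  take (e - s) (drop s z).

Definition posA_right (w : word) (i : nat) : nat :=
  nth (size w) (posA w) (numA w - i.+1).

Definition cond_iv (w z : word) : bool :=
  all (fun i =>
    let p := posA_right w i in
    [&& 0 < p, nth D w p.-1 == C & nth D w p.+1 == B] ==>
    (0 < count (pred1 B) (segment z i))) (iota 0 (numA w)).

Definition cond_v (w z : word) : bool :=
  all (fun i =>
    let p := posA_right w i in
    [&& 0 < p, nth D w p.-1 == C, nth D w p.+1 == B & nth D w p.+2 == B] ==>
    (1 < count (pred1 B) (segment z i))) (iota 0 (numA w)).

Definition good (w z : word) : bool :=
  [&& startsA w, startsA z, numA w == numA z, noCB w, noCB z,
      cond_iv w z & cond_v w z].

Definition kcount (n : nat) : nat :=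
  \sum_(m < n.+1)
    #|[set p : m.-tuple letter * (n - m).-tuple letter
        | good (tval p.1) (tval p.2) ]|.

Definition Kcoef (n : nat) : nat := if n < 2 then 0 else kcount n.

Local Open Scope ring_scope.

Definition Ktrunc (N : nat) : {poly int} :=
  \sum_(n < N) (Kcoef n)%:Z *: 'X^n.

Definition Knum : {poly int} := 'X^2 * (1 - 2%:R *: 'X) ^+ 2.
Definition Kden : {poly int} :=
  1 - 10%:R *: 'X + 38%:R *: 'X^2 - 70%:R *: 'X^3 + 66%:R *: 'X^4
    - 33%:R *: 'X^5 + 12%:R *: 'X^6 - 6%:R *: 'X^7 + 4%:R *: 'X^8 - 'X^9.

(* Main.v *)
(* Write w = A s_1 ... A s_k and z = A t_1 ... A t_k with segments s_i, t_i free
   of A.  Conditions (iv) and (v) only link s_i, the last letter of s_(i-1) and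
   t_(k+1-i), so the single word A s_1 A t_k A s_2 A t_(k-1) ... A s_k A t_1, of
   length |w| + |z|, can be checked from left to right by a finite automaton.
   Hence k_(n+1) is the number of words of length n accepted from one state, and
   the denominator of K is an annihilating recurrence for these numbers. *)
Require Import Defs.
From mathcomp Require Import all_boot all_order all_algebra zify.
Set Implicit Arguments. Unset Strict Implicit. Unset Printing Implicit Defensive.

(** * Cutting a word at its letters [A] *)

Definition join (ss : seq word) : word := flatten [seq A :: s | s <- ss].

Definition Afree (s : word) := A \notin s.

Lemma Afree_cons l s : Afree (l :: s) = (l != A) && Afree s.
Proof. by rewrite /Afree inE negb_or eq_sym. Qed.

(** The head piece is what precedes the first [A], hence [segs] drops it; the list of pieces is
    never empty. *)
Fixpoint pieces (w : word) : seq word :=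
  if w is l :: w' then
    let ss := pieces w' in
    if l == A then [::] :: ss else (l :: head [::] ss) :: behead ss
  else [:: [::]].

Definition segs w := behead (pieces w).

Lemma joinK w : startsA w -> join (segs w) = w.
Proof.
have H v : head [::] (pieces v) ++ join (behead (pieces v)) = v.
  elim: v => //= l v IH; case: eqP => [->|_] /=; last by rewrite IH.
  by rewrite -[in RHS]IH; case: v {IH} => //= l' v; case: ifP.
case: w => //= l w /eqP /= ->; rewrite /segs /= -[in RHS](H w).
by case: w => //= l' v; case: ifP.
Qed.

Lemma all_Afree_segs w : all Afree (segs w).
Proof.
have H v : all Afree (pieces v).
  elim: v => //= l v IH; case: eqP => [_|/eqP lA] //=.
  by case: (pieces v) IH => [|s ss] /=; rewrite Afree_cons lA.
by rewrite /segs; have := H w; case: pieces => //= s ss /andP[].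
Qed.

Lemma segsK ss : all Afree ss -> segs (join ss) = ss.
Proof.
have H s v : Afree s -> pieces (s ++ v) = (s ++ head [::] (pieces v)) :: behead (pieces v).
  elim: s => [|l s IH] /=; first by case: v => //= l v; case: ifP.
  by rewrite Afree_cons => /andP[/negPf -> /IH ->].
suff E : all Afree ss -> pieces (join ss) = [::] :: ss by move/E; rewrite /segs => ->.
by elim: ss => //= s ss IH /andP[sA /IH E]; rewrite H // -/(join ss) E /= cats0.
Qed.

Lemma size_join ss : size (join ss) = sumn [seq (size s).+1 | s <- ss].
Proof. by rewrite size_flatten /shape -map_comp. Qed.

Lemma numA_join ss : all Afree ss -> numA (join ss) = size ss.
Proof.
elim: ss => //= s ss IH /andP[sA /IH E].
by rewrite /numA /= count_cat -/(join ss) -/(numA (join ss)) E; move/count_memPn: sA => ->.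
Qed.

Lemma posA_cons l w : posA (l :: w) = [seq 0 | _ <- nseq (l == A) tt] ++ map succn (posA w).
Proof.
rewrite /posA /= -[1]/(1 + 0) iotaDl filter_map.
by case: eqP.
Qed.

Lemma posA_join ss : all Afree ss ->
  posA (join ss) = [seq size (join (take j ss)) | j <- iota 0 (size ss)].
Proof.
have H s v : Afree s -> posA (s ++ v) = [seq size s + i | i <- posA v].
  elim: s => [|l s IH] /=; first by rewrite map_id.
  rewrite Afree_cons => /andP[/negPf lA /IH E].
  by rewrite posA_cons lA E -map_comp.
elim: ss => //= s ss IH /andP[sA /IH E].
rewrite posA_cons /= H // -/(join _) E -[1]/(1 + 0) iotaDl -!map_comp.
by congr cons; apply: eq_map => i /=; rewrite size_cat.
Qed.

(** At [j = size ss] the default of [nth] takes over; it is the end of the word, which is where the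
    last segment ends. *)
Lemma nth_posA_join ss j : all Afree ss -> j <= size ss ->
  nth (size (join ss)) (posA (join ss)) j = size (join (take j ss)).
Proof.
move=> ssA; rewrite posA_join // leq_eqVlt => /predU1P[->|lt_j].
  by rewrite take_size nth_default // size_map size_iota.
by rewrite (nth_map 0) ?size_iota // nth_iota.
Qed.

Lemma join_cat ss us : join (ss ++ us) = join ss ++ join us.
Proof. by rewrite /join map_cat flatten_cat. Qed.

Lemma join_split ss j : j < size ss ->
  join ss = join (take j ss) ++ A :: nth [::] ss j ++ join (drop j.+1 ss).
Proof.
by move=> lt_j; rewrite -{1}(cat_take_drop j ss) join_cat (drop_nth [::]).
Qed.

Lemma segment_join ss j : all Afree ss -> j < size ss ->
  segment (join ss) j = A :: nth [::] ss j.
Proof.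
move=> ssA lt_j; rewrite /segment !nth_posA_join // 1?ltnW //.
rewrite (take_nth [::]) // -cats1 join_cat size_cat addnC addnK.
rewrite (join_split lt_j) drop_size_cat // -cat_cons take_size_cat //.
by rewrite /join /= cats0.
Qed.

(** * The conditions on a pair, segment by segment *)

Definition notCB (x y : letter) := ~~ ((x == C) && (y == B)).

Lemma noCB_sorted w : noCB w = sorted notCB w.
Proof.
rewrite /noCB -all_predC; elim: w => //= x w IH.
rewrite -[1]/(1 + 0) iotaDl all_map.
rewrite (eq_all (a2 := predC (fun i => (nth D w i == C) && (nth D w i.+1 == B)))) //.
by rewrite IH; case: w {IH} => [|y w] //; case: x.
Qed.

(** The [A] opening each segment keeps a factor [CB] from crossing a boundary, and a path from [A]
    leaves the first letter free. *)
Lemma noCB_join ss : noCB (join ss) = all (path notCB A) ss.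
Proof.
rewrite noCB_sorted; have -> w : sorted notCB w = path notCB A w by case: w.
suff H x : path notCB x (join ss) = all (path notCB A) ss by exact: H.
elim: ss x => //= s ss IH x.
by rewrite -/(join ss) cat_path IH; case: x.
Qed.

(* The number of letters B required of the partner of the segment s of w, where
   c tells whether s is preceded by CA. *)
Definition need (c : bool) (s : word) : nat :=
  if c && (nth D s 0 == B) then (nth D s 1 == B).+1 else 0.

Lemma letters_around ss j (w := join ss) (p := size (join (take j ss))) :
    j < size ss ->
  let s := nth [::] ss j in let after_C := (0 < j) && (last A (nth [::] ss j.-1) == C) in
  [&& 0 < p, nth D w p.-1 == C & nth D w p.+1 == B] = after_C && (nth D s 0 == B)
  /\ [&& 0 < p, nth D w p.-1 == C, nth D w p.+1 == B & nth D w p.+2 == B] =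
     [&& after_C, nth D s 0 == B & nth D s 1 == B].
Proof.
move=> lt_j /=.
have wE k : nth D w (p + k) = nth D (A :: nth [::] ss j ++ join (drop j.+1 ss)) k.
  by rewrite /w (join_split lt_j) nth_cat ltnNge leq_addr addKn.
(* The second letter is compared only jointly with the first: if the segment is empty, position
   [p.+2] may hold a [B] of the next segment. *)
have [hd1 hd2] : (nth D w p.+1 == B) = (nth D (nth [::] ss j) 0 == B) /\
   (nth D w p.+1 == B) && (nth D w p.+2 == B) =
    (nth D (nth [::] ss j) 0 == B) && (nth D (nth [::] ss j) 1 == B).
  rewrite -addn1 -[(p + 1).+1]addnS !wE /=.
  by case: (drop _ _) (nth [::] ss j) => [|t us] [|x [|y s]].
rewrite hd2 hd1 -!andbA.
case: j @p lt_j {wE hd1 hd2} => [|j] p lt_j /=; first by rewrite /p take0.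
have pE : join (take j.+1 ss) = join (take j ss) ++ A :: nth [::] ss j.
  by rewrite (take_nth [::]) 1?ltnW // -cats1 join_cat /join /= cats0.
have p0 : 0 < p by rewrite /p pE size_cat /= addnS.
rewrite p0 /w (join_split lt_j) nth_cat -/p prednK ?leqnn //.
by rewrite /p nth_last pE last_cat.
Qed.

Fixpoint compatible c (ps : seq (word * word)) : bool :=
  if ps is (s, u) :: ps' then
    [&& path notCB A s, path notCB A u, need c s <= count_mem B u &
      compatible (last A s == C) ps']
  else true.

Lemma compatibleE c ps : compatible c ps =
  [&& all (path notCB A) (unzip1 ps), all (path notCB A) (unzip2 ps) &
    all (fun j =>
      need (if j is j'.+1 then last A (nth [::] (unzip1 ps) j') == C else c)
           (nth [::] (unzip1 ps) j) <= count_mem B (nth [::] (unzip2 ps) j)) (iota 0 (size ps))].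
Proof.
elim: ps c => //= -[s u] ps IH c /=.
rewrite -[1]/(1 + 0) iotaDl all_map IH /=.
set b := all _ (iota _ _); set b' := all _ (iota _ _).
have -> : b' = b by apply: eq_all => -[|j].
by rewrite -!andbA; do !bool_congr.
Qed.

Lemma all_iota_rev (P : pred nat) n :
  all P (iota 0 n) = all (fun j => P (n - j.+1)) (iota 0 n).
Proof.
apply/allP/allP => H i; rewrite mem_iota => /= lt_i; first by apply: H; rewrite mem_iota; lia.
rewrite -[i](subKn (ltnW lt_i)) -(subnSK lt_i).
by apply: H; rewrite mem_iota; lia.
Qed.

(** Counting the segments of [w] from the left instead of the right reverses [ts]. Conditions (iv)
    and (v) ask for one and two letters [B], so together they are one lower bound by [need]. *)
Lemma conds_join ss ts : all Afree ss -> all Afree ts -> size ss = size ts ->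
  cond_iv (join ss) (join ts) && cond_v (join ss) (join ts) =
  all (fun j =>
      need (if j is j'.+1 then last A (nth [::] ss j') == C else false)
           (nth [::] ss j) <= count_mem B (nth [::] (rev ts) j)) (iota 0 (size ss)).
Proof.
move=> ssA tsA eq_st; rewrite /cond_iv /cond_v -all_predI numA_join // all_iota_rev.
apply: eq_in_all => j; rewrite mem_iota add0n /= => lt_j.
have le_j := ltnW lt_j.
rewrite /posA_right numA_join // subnSK // subKn // nth_posA_join //.
rewrite nth_rev -?eq_st // segment_join -?eq_st //; last by lia.
have [-> ->] := letters_around lt_j.
rewrite /need /= add0n; set k := count_mem _ _.
case: j {lt_j le_j} @k => [|j] k //=.
by do 3![case: (_ == _) => //=]; case: k => [|[]].
Qed.

(** * The automaton *)

(* [WStart]: just after the A opening a segment of w whose predecessor ends in C;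
   [WB]: the same followed by a single B.  In [W r c] the partner of the current
   segment of w needs r letters B; in [Z d r c] the current segment of z still
   needs r letters B and the previous segment of w ends in C iff d.  In both, c
   tells whether the last letter read is C. *)
Inductive state :=
  | WStart | WB | W of nat & bool | Z of bool & nat & bool.

Definition wstart c := if c then WStart else W 0 false.

Definition next q l : option state :=
  match q, l with
  | WStart, A => Some (Z false 0 false)
  | WStart, B => Some WB
  | WStart, C => Some (W 0 true)
  | WStart, D => Some (W 0 false)
  | WB, A => Some (Z false 1 false)
  | WB, B => Some (W 2 false)
  | WB, C => Some (W 1 true)
  | WB, D => Some (W 1 false)
  | W r c, A => Some (Z c r false)
  | W r c, B => if c then None else Some (W r false)
  | W r c, C => Some (W r true)
  | W r c, D => Some (W r false)
  | Z c r _, A => if r == 0 then Some (wstart c) else None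
  | Z c r c', B => if c' then None else Some (Z c r.-1 false)
  | Z c r _, C => Some (Z c r true)
  | Z c r _, D => Some (Z c r false)
  end.

Definition final q := if q is Z _ 0 _ then true else false.

Fixpoint naccepted n q : nat :=
  if n is n'.+1 then
    let f l := oapp (naccepted n') 0 (next q l) in f A + f B + f C + f D
  else final q.

Fixpoint accepts q (v : word) : bool :=
  if v is l :: v' then oapp (accepts^~ v') false (next q l) else final q.

Lemma accepts_W r x s v : Afree s ->
  accepts (W r (x == C)) (s ++ v) = path notCB x s && accepts (W r (last x s == C)) v.
Proof.
elim: s x => //= l s IH x; rewrite Afree_cons => /andP[lA /IH E].
by move: (E l); case: l x lA {E IH} => -[] // _ ->.
Qed.

(** Truncated subtraction matches [r.-1] in [next]: surplus letters [B] leave the demand at 0. *)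
Lemma accepts_Z c r x s v : Afree s ->
  accepts (Z c r (x == C)) (s ++ v) =
  path notCB x s && accepts (Z c (r - count_mem B s) (last x s == C)) v.
Proof.
elim: s x r => [|l s IH] x r /=; first by rewrite subn0.
rewrite Afree_cons => /andP[lA /IH E].
rewrite subnDA; move: (E l r) (E l r.-1).
by case: l x lA {E IH} => -[] // _ /= Er Er'; rewrite ?subn0 ?subn1.
Qed.

(** The closing [A] is included because a short [s] may end in [WStart] or [WB]; reading [A] turns
    each case into a [Z] state with the demand fixed. *)
Lemma accepts_start c s v : Afree s ->
  accepts (wstart c) (s ++ A :: v) =
  path notCB A s && accepts (Z (last A s == C) (need c s) false) v.
Proof.
have WE r x s' : Afree s' -> accepts (W r (x == C)) (s' ++ A :: v) =
    path notCB x s' && accepts (Z (last x s' == C) r false) v.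
  by move=> /accepts_W ->.
rewrite /need; case: c => /=; last exact: (WE 0 A).
case: s => [|l s] //; rewrite Afree_cons => /andP[lA sA].
case: l lA => // _ /=; [|exact: (WE 0 C)|exact: (WE 0 D)].
case: s sA => [|l s] //; rewrite Afree_cons => /andP[lA sA].
by case: l lA => // _ /=; [exact: (WE 2 B)|exact: (WE 1 C)|exact: (WE 1 D)].
Qed.

(** * Bijection between good pairs and recognized words *)

Definition mix (ps : seq (word * word)) : seq word :=
  flatten [seq [:: p.1; p.2] | p <- ps].

Fixpoint unmix (ss : seq word) : seq (word * word) :=
  if ss is s :: u :: ss' then (s, u) :: unmix ss' else [::].

Lemma mixK : cancel mix unmix.
Proof. by elim=> //= -[s u] ps ->. Qed.

Lemma unmixK ss : ~~ odd (size ss) -> mix (unmix ss) = ss.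
Proof.
move=> /negPf even_ss; have := odd_double_half (size ss); rewrite even_ss.
move: (size ss)./2 => k; elim: k ss {even_ss} => [|k IH] [|s [|u ss]] //;
  rewrite add0n doubleS => -[] // /IH E.
by rewrite /mix /= -[flatten _]/(mix _) E.
Qed.

Lemma accepts_join_mix c r l ps : all Afree (mix ps) ->
  accepts (Z c r l) (join (mix ps)) = (r == 0) && compatible c ps.
Proof.
elim: ps c r l => [|[s u] ps IH] c r l /=; first by case: r.
case/and3P=> sA uA psA; case: r => //=.
rewrite -[LHS]/(accepts (wstart c) (s ++ A :: u ++ join (mix ps))) accepts_start //.
by rewrite -[false]/(A == C) accepts_Z // IH.
Qed.

(** Each [A] switches between the [Z] states and the others, and every final state is a [Z]
    state. *)
Lemma accepts_parity q v : accepts q v -> odd (numA v) = if q is Z _ _ _ then false else true.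
Proof.
elim: v q => [|l v IH] q; first by case: q => // c [].
rewrite /numA /=; case E: next => [q'|] //= /IH; rewrite /numA oddD => ->.
case: q l E => [||r c|c r c'] [] //=; try by case=> <-.
- by case: c => // -[<-].
- by case: r => // -[<-]; case: c.
- by case: c' => // -[<-].
Qed.

(** Lists of segment pairs mediate the bijection: [pair_of] and [word_of] send the valid ones onto
    the good pairs and the recognized words. *)
Definition valid ps := [&& ps != [::], all Afree (mix ps) & compatible false ps].
Definition pair_of ps := (join (unzip1 ps), join (rev (unzip2 ps))).
Definition word_of ps := join (mix ps).
Definition recognized v := startsA v && accepts (Z false 0 false) v.
Definition enc (p : word * word) := word_of (zip (segs p.1) (rev (segs p.2))).
Definition dec v := pair_of (unmix (segs v)).

Lemma all_mix (P : pred word) ps :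
  all P (mix ps) = all P (unzip1 ps) && all P (unzip2 ps).
Proof. by elim: ps => //= -[s u] ps /= ->; rewrite -!andbA; do !bool_congr. Qed.

Lemma enc_pair_of ps : all Afree (mix ps) -> enc (pair_of ps) = word_of ps.
Proof.
rewrite all_mix => /andP[A1 A2]; rewrite /enc !segsK ?all_rev // revK.
by rewrite zip_unzip.
Qed.

Lemma dec_word_of ps : all Afree (mix ps) -> dec (word_of ps) = pair_of ps.
Proof. by move=> psA; rewrite /dec segsK // mixK. Qed.

Lemma startsA_join ss : startsA (join ss) = (ss != [::]).
Proof. by case: ss. Qed.

Lemma good_pair_of ps : all Afree (mix ps) ->
  good (pair_of ps).1 (pair_of ps).2 = valid ps.
Proof.
move=> psA; rewrite /valid psA; move: psA; rewrite all_mix => /andP[A1 A2].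
have A2r : all Afree (rev (unzip2 ps)) by rewrite all_rev.
rewrite /good /= !startsA_join !numA_join // size_rev !size_map eqxx /=.
rewrite !noCB_join conds_join ?size_rev ?size_map // revK compatibleE all_rev.
have -> : (unzip1 ps != [::]) = (ps != [::]) by case: ps {A1 A2 A2r}.
have -> : (rev (unzip2 ps) != [::]) = (ps != [::]).
  by rewrite -!size_eq0 size_rev size_map.
by case: (ps != [::]).
Qed.

Lemma recognized_word_of ps : all Afree (mix ps) -> recognized (word_of ps) = valid ps.
Proof.
move=> psA; rewrite /recognized /valid psA accepts_join_mix // startsA_join.
by case: ps {psA} => [|[s u] ps].
Qed.

Lemma goodP w z : good w z -> exists2 ps, valid ps & (w, z) = pair_of ps.
Proof.
move=> good_wz; have /and4P[wA zA /eqP eq_num _] := good_wz.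
have sz : size (segs w) = size (rev (segs z)).
  by rewrite size_rev -!numA_join ?all_Afree_segs // !joinK.
pose ps := zip (segs w) (rev (segs z)).
have E : (w, z) = pair_of ps.
  by rewrite /pair_of unzip1_zip ?sz // unzip2_zip ?sz // revK !joinK.
exists ps => //; rewrite -good_pair_of -?E //.
by rewrite all_mix unzip1_zip ?sz // unzip2_zip ?sz // all_rev !all_Afree_segs.
Qed.

Lemma recognizedP v : recognized v -> exists2 ps, valid ps & v = word_of ps.
Proof.
move=> rec_v; have /andP[vA acc_v] := rec_v.
have even_v : ~~ odd (size (segs v)).
  by rewrite -numA_join ?all_Afree_segs // joinK // (accepts_parity acc_v).
have E : v = word_of (unmix (segs v)) by rewrite /word_of unmixK // joinK.
exists (unmix (segs v)) => //.
by rewrite -recognized_word_of -?E // unmixK // all_Afree_segs.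
Qed.

Lemma size_word_of ps :
  size (word_of ps) = size (pair_of ps).1 + size (pair_of ps).2.
Proof.
rewrite !size_join map_rev sumn_rev.
by elim: ps => //= -[s u] ps /= ->; lia.
Qed.

Lemma enc_spec w z : good w z ->
  [/\ recognized (enc (w, z)), size (enc (w, z)) = size w + size z &
      dec (enc (w, z)) = (w, z)].
Proof.
case/goodP=> ps ps_ok wzE; have /and3P[_ psA _] := ps_ok.
have [-> ->] : w = (pair_of ps).1 /\ z = (pair_of ps).2 by rewrite -wzE.
by rewrite -surjective_pairing enc_pair_of // recognized_word_of // dec_word_of // size_word_of.
Qed.

Lemma dec_spec v : recognized v ->
  [/\ good (dec v).1 (dec v).2, size v = size (dec v).1 + size (dec v).2 & enc (dec v) = v].
Proof.
case/recognizedP=> ps ps_ok ->; have /and3P[_ psA _] := ps_ok.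
by rewrite dec_word_of // good_pair_of // enc_pair_of // size_word_of.
Qed.

Lemma kcountE n : kcount n = #|[set v : n.-tuple letter | recognized v]|.
Proof.
rewrite cardsE -sum1_card.
(* Sorting the recognized words by the length of the decoded [w] matches the sum over [m] term by
   term. *)
rewrite (partition_big
  (fun v : n.-tuple letter => inord (size (dec v).1) : 'I_n.+1) xpredT) //=.
apply: eq_bigr => m _; rewrite cardsE -sum1_card; symmetry.
have le_mn : m <= n by rewrite -ltnS.
pose f (p : m.-tuple letter * (n - m).-tuple letter) : n.-tuple letter :=
  insubd (nseq_tuple n D) (enc (tval p.1, tval p.2)).
pose g (v : n.-tuple letter) : m.-tuple letter * (n - m).-tuple letter :=
  (insubd (nseq_tuple m D) (dec v).1, insubd (nseq_tuple (n - m) D) (dec v).2).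
have val_f p : good (tval p.1) (tval p.2) -> val (f p) = enc (tval p.1, tval p.2).
  case/enc_spec=> _ sz _.
  by rewrite val_insubd sz !size_tuple subnKC // eqxx.
have val_g (v : n.-tuple letter) : recognized v -> inord (size (dec v).1) == m ->
    (g v).1 = (dec v).1 :> word /\ (g v).2 = (dec v).2 :> word.
  case/dec_spec=> _; rewrite size_tuple => sz _ /eqP/(congr1 val) /=.
  rewrite inordK => [sz1|]; last by rewrite ltnS [leqRHS]sz leq_addr.
  have sz2 : size (dec v).2 = n - m by rewrite -sz1 [X in X - _]sz addKn.
  by split; rewrite [LHS]val_insubd ?sz1 ?sz2 eqxx.
rewrite (reindex_onto f g) => [|v /andP[rec_v sz_v]]; last first.
  have [g1 g2] := val_g v rec_v sz_v; have [good_v _ encK] := dec_spec rec_v.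
  by apply: val_inj; rewrite val_f ?g1 ?g2.
apply: eq_bigl => p.
(* Even where [f p] is only the fallback tuple, being recognized and decoding back to [p] would make
   [p] good. *)
apply/idP/idP => [/andP[/andP[rec_v sz_v] /eqP gfp]|good_p].
  have [g1 g2] := val_g _ rec_v sz_v; have [+ _ _] := dec_spec rec_v.
  by rewrite -g1 -g2 gfp.
have [rec_p _ decK] := enc_spec (good_p : good p.1 p.2).
have rec_v : recognized (f p) by rewrite val_f.
have sz_v : inord (size (dec (f p)).1) == m.
  by rewrite val_f // decK size_tuple; apply/eqP/val_inj; rewrite /= inordK.
apply/andP; split; first by apply/andP.
have [] := val_g _ rec_v sz_v; rewrite val_f // decK => g1 g2.
by rewrite [g _]surjective_pairing (val_inj g1) (val_inj g2) -surjective_pairing.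
Qed.

(** * Counting accepted words by their first letter *)

Lemma big_letter (F : letter -> nat) : \sum_l F l = F A + F B + F C + F D.
Proof.
rewrite (perm_big [:: A; B; C; D]) /=; last first.
  by apply: uniq_perm; rewrite ?index_enum_uniq // => -[]; rewrite mem_index_enum.
by rewrite unlock /= addn0 !addnA.
Qed.

Lemma card_tuple_cons n (P : pred word) :
  #|[set v : n.+1.-tuple letter | P v]| =
  \sum_l #|[set v : n.-tuple letter | P (l :: v)]|.
Proof.
under [RHS]eq_bigr do rewrite cardsE -sum1_card.
rewrite pair_big_dep cardsE -sum1_card /=.
rewrite (reindex (fun p : letter * n.-tuple letter => cons_tuple p.1 p.2)) //.
by exists (fun v => (thead v, behead_tuple v)) => [[l v] _|v _];
  [congr pair; apply: val_inj | rewrite [RHS]tuple_eta].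
Qed.

Lemma card_accepts n q : #|[set v : n.-tuple letter | accepts q v]| = naccepted n q.
Proof.
elim: n q => [|n IH] q.
  rewrite cardsE (eq_card (B := fun=> final q)) => [|v]; last by rewrite tuple0.
  by rewrite /=; case: final; rewrite ?card0 // cardT -cardE card_tuple.
rewrite card_tuple_cons big_letter /=.
suff E l : #|[set v : n.-tuple letter | accepts q (l :: v)]| = oapp (naccepted n) 0 (next q l).
  by rewrite !E.
rewrite /=; case: next => [q'|] /=; first exact: IH.
by rewrite -[RHS](cards0 (n.-tuple letter)); apply: eq_card => v; rewrite !inE.
Qed.

(** The first letter must be [A], and it leads from the initial state [Z false 0 false] to
    [W 0 false]. *)
Lemma kcountS n : kcount n.+1 = naccepted n (W 0 false).
Proof.
rewrite kcountE card_tuple_cons big_letter -card_accepts.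
have E l : l != A -> #|[set v : n.-tuple letter | recognized (l :: v)]| = 0.
  move=> /negPf lA; apply/eqP; rewrite cards_eq0; apply/eqP/setP => v.
  by rewrite !inE /recognized /startsA /= lA.
by rewrite (E B) // ?(E C) // ?(E D) // !addn0.
Qed.

(* Unfolding nine transitions reduces the recurrence below to a linear relation
   between the counts of the states; it and its consequences under one more
   transition span the two relations stated here. *)
Lemma naccepted_relations n (w := fun r l => naccepted n (W r l))
    (z := fun c r l => naccepted n (Z c r l)) :
  w 0 false + w 2 true + z false 2 true + z true 2 false =
    w 1 true + w 2 false + z false 1 false + z false 2 false +
    z true 1 true + 2 * z true 2 true
  /\
  w 0 true + w 1 true + w 2 false + z false 2 false + z true 1 true +
    3 * z true 2 true =
    w 1 false + 2 * w 2 true + z false 1 true + 2 * z false 2 true +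
    z true 1 false + 2 * z true 2 false.
(* As left minus right, one transition turns the first relation into twice itself plus the second,
   and the second into the sum of both. *)
Proof. by rewrite {}/w {}/z; elim: n => [|n /= [IH1 IH2]] //=; lia. Qed.

Lemma naccepted_recurrence n (k := fun m => naccepted m (W 0 false)) :
  k (n + 9) + 38 * k (n + 7) + 66 * k (n + 5) + 12 * k (n + 3) + 4 * k (n + 1) =
  10 * k (n + 8) + 70 * k (n + 6) + 33 * k (n + 4) + 6 * k (n + 2) + k n.
Proof.
have startS m : naccepted m.+1 WStart =
  naccepted m (Z false 0 false) + naccepted m WB + naccepted m (W 0 true) +
  naccepted m (W 0 false) by [].
have WBS m : naccepted m.+1 WB =
  naccepted m (Z false 1 false) + naccepted m (W 2 false) + naccepted m (W 1 true) +
  naccepted m (W 1 false) by [].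
have WfS m r : naccepted m.+1 (W r false) =
  naccepted m (Z false r false) + naccepted m (W r false) + naccepted m (W r true) +
  naccepted m (W r false) by [].
have WtS m r : naccepted m.+1 (W r true) =
  naccepted m (Z true r false) + naccepted m (W r true) + naccepted m (W r false)
  by rewrite /= addn0.
have Zf0 m c : naccepted m.+1 (Z c 0 false) =
  naccepted m (wstart c) + naccepted m (Z c 0 false) + naccepted m (Z c 0 true) +
  naccepted m (Z c 0 false) by [].
have ZfS m c r : naccepted m.+1 (Z c r.+1 false) =
  naccepted m (Z c r false) + naccepted m (Z c r.+1 true) + naccepted m (Z c r.+1 false) by [].
have Zt0 m c : naccepted m.+1 (Z c 0 true) =
  naccepted m (wstart c) + naccepted m (Z c 0 true) + naccepted m (Z c 0 false)
  by rewrite /= addn0.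
have ZtS m c r : naccepted m.+1 (Z c r.+1 true) =
  naccepted m (Z c r.+1 true) + naccepted m (Z c r.+1 false) by [].
have Wsteps m := conj (conj (startS m) (WBS m))
  (conj (conj (WfS m 0) (conj (WfS m 1) (WfS m 2)))
        (conj (WtS m 0) (conj (WtS m 1) (WtS m 2)))).
have Zsteps m c := conj (conj (Zf0 m c) (conj (ZfS m c 0) (ZfS m c 1)))
  (conj (Zt0 m c) (conj (ZtS m c 0) (ZtS m c 1))).
have steps m := conj (Wsteps m) (conj (Zsteps m true) (Zsteps m false)).
move: (steps n) (steps n.+1) (steps n.+2) (steps n.+3) (steps n.+4)
  (steps n.+4.+1) (steps n.+4.+2) (steps n.+4.+3) (steps n.+4.+4) (naccepted_relations n).
by clear; rewrite {}/k !addnS !addn0 /wstart; lia.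
Qed.

(** * The generating function *)

Arguments naccepted : simpl never.

Import GRing.Theory.
Local Open Scope ring_scope.

(** At [i = 1] both sides vanish, since [W 0 false] is not final. *)
Lemma KcoefE i : Kcoef i = if i is n.+1 then naccepted n (W 0 false) else 0%N.
Proof. by case: i => [|[|n]] //; rewrite /Kcoef kcountS. Qed.

Lemma coef_Ktrunc N i : (i < N)%N -> (Ktrunc N)`_i = (Kcoef i)%:Z.
Proof.
by move=> lt_iN; rewrite /Ktrunc -(poly_def N (fun i => (Kcoef i)%:Z)) coef_poly lt_iN.
Qed.

(* K(x) = Knum / Kden as formal power series (Kden has constant term 1),
   i.e. Kden * K = Knum, checked coefficientwise on every truncation. *)
Theorem theorem4p2 :
  forall (N i : nat), (i < N)%N -> (Kden * Ktrunc N)`_i = Knum`_i.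
Proof.
move=> N i lt_iN.
have cE j c : (c *: 'X^j * Ktrunc N)`_i = if (i < j)%N then 0 else c * (Kcoef (i - j))%:Z.
  rewrite -scalerAl coefZ coefXnM; case: ltnP => _; first by rewrite mulr0.
  by rewrite coef_Ktrunc // (leq_ltn_trans (leq_subr _ _)).
have cE1 j : ('X^j * Ktrunc N)`_i = if (i < j)%N then 0 else (Kcoef (i - j))%:Z.
  by have := cE j 1; rewrite scale1r mul1r.
rewrite /Kden !mulrDl !mulNr !coefD !coefN !cE cE1 (cE 1) mul1r coef_Ktrunc //.
have -> : Knum = 'X^2 - 4 *: 'X^3 + 4 *: 'X^4.
  rewrite /Knum sqrrB expr1n mul1r -scaler_nat scalerA exprZn mulrDr mulrBr mulr1.
  by rewrite -!scalerAr -exprSr -exprD.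
rewrite !coefD coefN !coefZ !coefXn !KcoefE.
(* Coefficient [i] involves word lengths [i - 10] to [i - 1], so the recurrence covers [i >= 10],
   where the numerator vanishes; the ten earlier coefficients are computed. *)
case: (ltnP i 10) => [|le10i].
  by clear; do 10![case: i => [|i] //].
rewrite -(subnK le10i); set n := (i - 10)%N.
have := naccepted_recurrence n; rewrite !addnS !subSS !subn0 !addn0 /=; lia.
Qed.
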